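(* Let $R$ be a commutative ring with identity, let $A\in M_{s\times s}(R)$ be non-singular and orthogonal (i.e. $A=(A^{-1})^t$), and let $C_1,\dots,C_s$ be linear codes of length $m$ over $R$. Then: 1. $([C_1\,\dots\,C_s]\,A)^\perp=[C_1^\perp\,\dots\,C_s^\perp]\,A$. 2. If $C_i$ is self-orthogonal for each $i=1,\dots,s$, then so is $[C_1\,\dots\,C_s]\,A$. 3. If $C_i$ is self-dual for each $i=1,\dots,s$, then so is $[C_1\,\dots\,C_s]\,A$. 4. If $C_i^\perp\subseteq C_i$ for each $i=1,\dots,s$, then $([C_1\,\dots\,C_s]\,A)^\perp\subseteq[C_1\,\dots\,C_s]\,A$.
   Context: $M_{s\times s}(R)$ is the set of $s\times s$ matrices over $R$; $A$ is non-singular (invertible) if $\det(A)$ is a unit of $R$; $^t$ denotes transpose. A linear code of length $m$ over $R$ is an $R$-submodule of $R^m$. With $\langle x,y\rangle=\sum_{k} x_ky_k$, the dual of a linear code $C\subseteq R^m$ is $C^\perp=\{x\in R^m : \langle x,c\rangle=0 \text{ for all } c\in C\}$; $C$ is self-orthogonal if $C\subseteq C^\perp$ and self-dual if $C=C^\perp$. For linear codes $C_1,\dots,C_s$ of length $m$ and $A=(a_{i,j})\in M_{s\times s}(R)$, the matrix-product code is $[C_1\,\dots\,C_s]\,A=\{(c_1\,\dots\,c_s)A : c_i\in C_i\}$, where $(c_1\,\dots\,c_s)$ is the $m\times s$ matrix whose $i$th column is $c_i$. It is viewed as a linear code of length $ms$ by identifying an $m\times s$ matrix with the concatenation of its columns,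 so its codewords are $\left(\sum_{i=1}^s a_{i,1}c_i,\dots,\sum_{i=1}^s a_{i,s}c_i\right)$ with $c_i\in C_i$. *)

(* Defs.v *)
From mathcomp Require Import all_boot all_algebra.
From mathcomp Require Import boolp classical_sets.

Set Implicit Arguments.
Unset Strict Implicit.
Unset Printing Implicit Defensive.

Import GRing.Theory.

Local Open Scope ring_scope.
Local Open Scope classical_set_scope.

(* [comPzRingType] is an arbitrary commutative ring with identity (the zero   *)
(* ring included).  The structures providing [GRing.unit] and [invmx] assume  *)
(* in addition that 1 != 0, so units and inverse matrices are spelled out.    *)
Definition nonsingular (R : comPzRingType) (s : nat) (A : 'M[R]_s) : Prop :=
  exists u : R, u * \det A = 1.

Definition is_inverse_mx (R : comPzRingType) (s : nat) (A B : 'M[R]_s) : Prop :=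
  A *m B = 1%:M /\ B *m A = 1%:M.

Definition orthogonal_mx (R : comPzRingType) (s : nat) (A : 'M[R]_s) : Prop :=
  exists2 B : 'M[R]_s, is_inverse_mx A B & A = B^T.

Definition linear_code (R : comPzRingType) (m : nat) (C : set 'rV[R]_m) : Prop :=
  GRing.submod_closed (mem C).

Definition dot (R : comPzRingType) (m : nat) (x y : 'rV[R]_m) : R :=
  \sum_(k < m) x 0 k * y 0 k.

Definition dual_code (R : comPzRingType) (m : nat) (C : set 'rV[R]_m) :
    set 'rV[R]_m :=
  [set x | forall c, C c -> dot x c = 0].

Definition self_orthogonal (R : comPzRingType) (m : nat) (C : set 'rV[R]_m) :
    Prop :=
  C `<=` dual_code C.

Definition self_dual (R : comPzRingType) (m : nat) (C : set 'rV[R]_m) : Prop :=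
  C = dual_code C.

(* The m x s matrix whose i-th column is c i. *)
Definition cols_mx (R : comPzRingType) (m s : nat) (c : 'I_s -> 'rV[R]_m) :
    'M[R]_(m, s) :=
  \matrix_(k < m, i < s) c i 0 k.

(* [mxvec] concatenates the rows of its argument, whence the transpose. *)
Definition concat_cols (R : comPzRingType) (m s : nat) (M : 'M[R]_(m, s)) :
    'rV[R]_(s * m) :=
  mxvec M^T.

Definition matrix_product_code (R : comPzRingType) (m s : nat)
    (C : 'I_s -> set 'rV[R]_m) (A : 'M[R]_s) : set 'rV[R]_(s * m) :=
  [set concat_cols (cols_mx c *m A) | c in [set c | forall i, C i (c i)]].

Lemma concat_cols_mulE (R : comPzRingType) (m s : nat) (c : 'I_s -> 'rV[R]_m)
    (A : 'M[R]_s) :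
  concat_cols (cols_mx c *m A) =
  mxvec (\matrix_(j < s) \sum_(i < s) A i j *: c i).
Proof.
congr mxvec; apply/matrixP => j k; rewrite !mxE summxE.
by apply: eq_bigr => i _; rewrite !mxE mulrC.
Qed.

Lemma linear_dual_code (R : comPzRingType) (m : nat) (C : set 'rV[R]_m) :
  linear_code (dual_code C).
Proof.
split=> [|a x y]; rewrite !inE /=.
  by move=> c _; rewrite /dot big1 // => k _; rewrite mxE mul0r.
move=> xC yC c Cc; have: a * dot x c + dot y c = 0.
  by rewrite xC // yC // mulr0 addr0.
move=> <-; rewrite /dot mulr_sumr -big_split /=.
by apply: eq_bigr => k _; rewrite !mxE mulrDl mulrA.
Qed.

Lemma linear_matrix_product_code (R : comPzRingType) (m s : nat)
    (C : 'I_s -> set 'rV[R]_m) (A : 'M[R]_s) :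
  (forall i, linear_code (C i)) -> linear_code (matrix_product_code C A).
Proof.
move=> linC; split=> [|a x y]; rewrite !inE /=.
  exists (fun=> 0).
    by move=> i; have [] := linC i; rewrite inE.
  rewrite concat_cols_mulE -[RHS](linear0 mxvec); congr mxvec.
  by apply/row_matrixP => j; rewrite rowK row0 big1 // => i _; rewrite scaler0.
case=> c Cc <- [d Cd <-]; exists (fun i => a *: c i + d i).
  move=> i; have [_ /(_ a (c i) (d i))] := linC i.
  by rewrite !inE; apply.
rewrite !concat_cols_mulE -linearP; congr mxvec.
apply/matrixP => j k; rewrite !mxE !summxE mulr_sumr -big_split /=.
by apply: eq_bigr => i _; rewrite !mxE mulrDr mulrCA.
Qed.

(* Main.v *)
(* Dot products of concatenations are traces: <M, N> = tr(M^T N).  Hence for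
   A A^T = 1 the right multiplication by A preserves dot products of m x s
   matrices, and it is bijective with inverse the multiplication by A^T.  The
   dual of [C_1 ... C_s] A is thus the image by A of the dual of C_1 x ... x C_s,
   which is the product of the duals since each C_i contains 0; the other items
   follow by monotonicity in the C_i. *)
Require Import Defs.
From mathcomp Require Import all_boot all_algebra.
From mathcomp Require Import boolp classical_sets.

Set Implicit Arguments.
Unset Strict Implicit.
Unset Printing Implicit Defensive.

Import GRing.Theory.

Local Open Scope ring_scope.
Local Open Scope classical_set_scope.

Lemma dot_concat_cols (R : comPzRingType) (m s : nat) (M N : 'M[R]_(m, s)) :
  dot (concat_cols M) (concat_cols N) = \tr (M^T *m N).
Proof.
under [RHS]eq_bigr => i _ do rewrite mxE.
(* Positions in the concatenation correspond to pairs (column, row), the same pairs that index the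
   double sum of the trace. *)
rewrite pair_bigA /dot (reindex _ (curry_mxvec_bij _ _)) /=.
by apply: eq_bigr => -[i j] _; rewrite /concat_cols !mxvecE !mxE.
Qed.

Lemma mxtrace_cols_mx (R : comPzRingType) (m s : nat)
    (c d : 'I_s -> 'rV[R]_m) :
  \tr ((cols_mx c)^T *m cols_mx d) = \sum_i dot (c i) (d i).
Proof.
by apply: eq_bigr => i _; rewrite mxE; apply: eq_bigr => k _; rewrite !mxE.
Qed.

Lemma orthogonal_mx_mul_tr (R : comPzRingType) (s : nat) (A : 'M[R]_s) :
  orthogonal_mx A -> A *m A^T = 1%:M /\ A^T *m A = 1%:M.
Proof. by case=> B [AB BA] E; have -> : A^T = B by rewrite E trmxK. Qed.

Lemma dot_concat_cols_orthogonal (R : comPzRingType) (m s : nat) (A : 'M[R]_s)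
    (c d : 'I_s -> 'rV[R]_m) :
  orthogonal_mx A ->
  dot (concat_cols (cols_mx c *m A)) (concat_cols (cols_mx d *m A)) =
  \sum_i dot (c i) (d i).
Proof.
move=> /orthogonal_mx_mul_tr[AAT _].
(* Cyclicity of the trace moves the leading [A^T] to the far right, where it cancels against [A]. *)
rewrite dot_concat_cols trmx_mul -mulmxA mxtrace_mulC -!mulmxA AAT mulmx1.
exact: mxtrace_cols_mx.
Qed.

Lemma concat_cols_orthogonal_surj (R : comPzRingType) (m s : nat) (A : 'M[R]_s)
    (x : 'rV[R]_(s * m)) :
  orthogonal_mx A -> exists c, x = concat_cols (cols_mx c *m A).
Proof.
move=> /orthogonal_mx_mul_tr[_ ATA].
(* [(vec_mx x)^T] has the successive blocks of [x] as columns; the columns of [N] give the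
   preimage. *)
pose N : 'M[R]_(m, s) := (vec_mx x)^T *m A^T.
exists (fun i => (col i N)^T).
have -> : cols_mx (fun i => (col i N)^T) = N.
  by apply/matrixP => k i; rewrite !mxE.
by rewrite -mulmxA ATA mulmx1 /concat_cols trmxK vec_mxK.
Qed.

Lemma dot0r (R : comPzRingType) (m : nat) (x : 'rV[R]_m) : dot x 0 = 0.
Proof. by rewrite /dot big1 // => k _; rewrite mxE mulr0. Qed.

Lemma matrix_product_codeS (R : comPzRingType) (m s : nat) (A : 'M[R]_s)
    (C D : 'I_s -> set 'rV[R]_m) :
  (forall i, C i `<=` D i) ->
  matrix_product_code C A `<=` matrix_product_code D A.
Proof. by move=> CD _ [c Cc <-]; exists c => // i; apply/CD/Cc. Qed.

Lemma dual_matrix_product_code (R : comPzRingType) (m s : nat) (A : 'M[R]_s)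
    (C : 'I_s -> set 'rV[R]_m) :
  orthogonal_mx A -> (forall i, C i 0) ->
  dual_code (matrix_product_code C A) =
  matrix_product_code (fun i => dual_code (C i)) A.
Proof.
move=> oA C0; apply/seteqP; split=> [x dual_x | _ [d Dd <-] _ [c Cc <-]].
  have [d x_eq] := concat_cols_orthogonal_surj x oA.
  (* Testing [x] against the codeword built from [c] in position [i] and zeros elsewhere isolates
     [dot (d i) c]; [C0] makes this family admissible. *)
  exists d => // i c Cic; pose e j := if j == i then c else 0.
  have Ce j : C j (e j) by rewrite /e; case: eqP => [->|].
  have := dual_x _ (ex_intro2 _ _ e Ce erefl).
  rewrite x_eq dot_concat_cols_orthogonal // (bigD1 i) //= /e eqxx.
  rewrite big1 ?addr0 // => j /negPf ->; exact: dot0r.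
by rewrite dot_concat_cols_orthogonal // big1 // => i _; apply: Dd.
Qed.

Theorem corollary3p4 (R : comPzRingType) (m s : nat) (A : 'M[R]_s)
    (C : 'I_s -> set 'rV[R]_m)
    (A_nonsingular : nonsingular A) (A_orthogonal : orthogonal_mx A)
    (C_linear : forall i, linear_code (C i)) :
  [/\ dual_code (matrix_product_code C A) =
        matrix_product_code (fun i => dual_code (C i)) A,
      (forall i, self_orthogonal (C i)) ->
        self_orthogonal (matrix_product_code C A),
      (forall i, self_dual (C i)) ->
        self_dual (matrix_product_code C A)
    & (forall i, dual_code (C i) `<=` C i) ->
        dual_code (matrix_product_code C A) `<=` matrix_product_code C A].
Proof.
have C0 i : C i 0 by have [] := C_linear i; rewrite inE.
(* Once the dual is rewritten, each remaining item compares two product codes with the same [A]. *)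
rewrite /self_orthogonal /self_dual dual_matrix_product_code //.
split=> // [CS | CE | CS]; try exact: matrix_product_codeS.
by congr matrix_product_code; apply: funext.
Qed.
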